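(* Let $\{k_1,k_2,\dots,k_m\}$ be a finite subset of a real Hilbert space $H$, let $C:=\left\{\sum_{i=1}^m\rho_i k_i\mid\rho_i\ge 0\text{ for all }i\right\}$ be the (closed) convex cone it generates, and let $S:\mathbb{R}^m\to H$ be the bounded linear operator $S(\alpha)=\sum_{i=1}^m\alpha_i k_i$ for all $\alpha=(\alpha_1,\dots,\alpha_m)\in\mathbb{R}^m$. For each $x\in H$, let $x_0:=x-(S^* )^\dagger S^*(x)$. Then $x_0\in\mathcal{N}(S^* )$ and there exist $\rho,\eta\in\mathbb{R}^m$ such that (1) $x=S(\rho)+x_0-(S^* )^\dagger(\eta)$. (2) $\rho\ge 0$, $\eta\ge 0$, $\eta\in\mathcal{N}(S)^\perp$, and $\langle\rho,\eta\rangle=0$. (3) $P_{C^\ominus}(x)=x_0-(S^* )^\dagger(\eta)$, and $\langle x_0,(S^* )^\dagger(\eta)\rangle=0$. (4) $P_C(x)=S(\rho)=(S^* )^\dagger[S^*(x)+\eta]$.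
   Context: All spaces are real. $S^*:H\to\mathbb{R}^m$ is the adjoint of $S$, $\mathcal{N}(\cdot)$ denotes the null space, and $^\perp$ the orthogonal complement. For $\rho\in\mathbb{R}^m$, $\rho\ge 0$ means $\rho_i\ge 0$ for each $i$. For $D\subset H$, $D^\ominus:=\{y\in H\mid\langle y,d\rangle\le 0\text{ for all }d\in D\}$. For a nonempty closed convex set $D$, $P_D(x)$ is the unique nearest point to $x$ in $D$. For a bounded linear operator $T:H_1\to H_2$ with closed range between Hilbert spaces, the generalized inverse $T^\dagger:H_2\to H_1$ is defined by letting $T^\dagger(y)$ be the minimal norm element of the set $G(y)=\{u\in H_1\mid\|T(u)-y\|\le\|T(v)-y\|\text{ for all }v\in H_1\}$ of generalized solutions of $T(u)=y$. Both $S$ and $S^*$ have closed range. *)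

(* Defs.v *)
From HB Require Import structures.
From mathcomp Require Import all_boot all_order all_algebra sesquilinear.
From mathcomp Require Import all_classical all_reals topology normedtype.
From mathcomp Require Import ring.

Set Implicit Arguments.
Unset Strict Implicit.
Unset Printing Implicit Defensive.

Import Order.TTheory GRing.Theory Num.Theory.
Import numFieldNormedType.Exports.

Local Open Scope classical_set_scope.
Local Open Scope ring_scope.

HB.mixin Record CompleteNormedModule_isHilbert (R : realType) H
    & CompleteNormedModule R H := {
  inner : {dot H for idfun} ;
  inner_norm : forall u : H, inner u u = `|u| ^+ 2
}.

#[short(type="hilbertType")]
HB.structure Definition Hilbert (R : realType) :=
  {H of CompleteNormedModule_isHilbert R H & CompleteNormedModule R H}.

Notation "''[' u , v ]" := (inner u v) : ring_scope.

(* R^m with its Euclidean structure; an alias is needed because the library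
   equips 'rV[R]_m with the sup norm. *)
Definition euclid (R : realType) (m : nat) : Type := 'rV[R]_m.

Section Euclid.
Context {R : realType} {m : nat}.
Local Notation E := (euclid R m).
Implicit Types u v : E.

HB.instance Definition _ := GRing.Lmodule.on E.

Definition edot u v : R := \sum_i u 0 i * v 0 i.

Fact edot_bilinear :
  bilinear_for *%R (idfun \; *%R) (edot : E -> E -> R).
Proof.
split=> [v a x y|u a x y]; rewrite /edot /= mulr_sumr -big_split/=;
  by apply: eq_bigr => i _; rewrite !mxE ?(mulrDl, mulrDr) ?mulrA// (mulrC a).
Qed.

HB.instance Definition _ :=
  bilinear_isBilinear.Build R E E R *%R (idfun \; *%R) edot edot_bilinear.

Fact edot_hermitian u v : edot u v = (-1) ^+ false * idfun (edot v u).
Proof. by rewrite expr0 mul1r; apply: eq_bigr => i _; rewrite mulrC. Qed.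

HB.instance Definition _ :=
  isHermitianSesquilinear.Build R E false idfun edot edot_hermitian.

Lemma edotC u v : edot u v = edot v u.
Proof. by rewrite edot_hermitian expr0 mul1r. Qed.

Lemma edot_ge0 u : 0 <= edot u u.
Proof. by apply: sumr_ge0 => i _; rewrite -expr2 sqr_ge0. Qed.

Lemma edot_eq0 u : edot u u = 0 -> u = 0.
Proof.
move=> u0; apply/rowP => i; rewrite mxE; apply/eqP.
rewrite -sqrf_eq0 expr2; apply/eqP.
by apply: (psumr_eq0P _ u0) => // j _; rewrite -expr2 sqr_ge0.
Qed.

Fact edot_gt0 u : u != 0 -> 0 < edot u u.
Proof.
move=> u0; rewrite lt_neqAle edot_ge0 andbT eq_sym.
by apply: contra u0 => /eqP/edot_eq0 ->.
Qed.

HB.instance Definition _ := isDotProduct.Build R E edot edot_gt0.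

Definition enorm u : R := Num.sqrt (edot u u).

Lemma sqr_enorm u : enorm u ^+ 2 = edot u u.
Proof. exact/sqr_sqrtr/edot_ge0. Qed.

Lemma enorm_ge0 u : 0 <= enorm u. Proof. exact: sqrtr_ge0. Qed.

Lemma edotDl u v w : edot (u + v) w = edot u w + edot v w.
Proof. exact: linearDl. Qed.

Lemma edotDr u v w : edot w (u + v) = edot w u + edot w v.
Proof. by rewrite edotC edotDl !(edotC w). Qed.

Lemma edotZl a u w : edot (a *: u) w = a * edot u w.
Proof. exact: linearZl_LR. Qed.

Lemma edotZr a u w : edot w (a *: u) = a * edot w u.
Proof. by rewrite edotC edotZl edotC. Qed.

Lemma edot_le u v : edot u v <= enorm u * enorm v.
Proof.
have [->|v0] := eqVneq v 0.
  rewrite /enorm -(scale0r (0 : E)) !edotZr !mul0r sqrtr0 mulr0 //.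
have vv := edot_gt0 v0.
have := edot_ge0 (edot v v *: u + (- edot u v) *: v).
rewrite edotDl !edotDr !edotZl !edotZr (edotC v u).
rewrite [X in 0 <= X](_ : _ = edot v v * (edot u u * edot v v - edot u v ^+ 2));
  last by ring.
rewrite pmulr_rge0// subr_ge0 => uv.
apply: (le_trans (ler_norm _)); rewrite -(@ler_pXn2r _ 2) ?nnegrE//.
  by rewrite -normrX ger0_norm ?sqr_ge0// exprMn !sqr_enorm.
by rewrite mulr_ge0 ?enorm_ge0.
Qed.

Fact enormD u v : enorm (u + v) <= enorm u + enorm v.
Proof.
rewrite -(@ler_pXn2r _ 2) ?nnegrE ?addr_ge0 ?enorm_ge0//.
rewrite sqrrD !sqr_enorm edotDl !edotDr (edotC v u).
rewrite -!addrA lerD2l !addrA lerD2r -mulr2n.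
by rewrite lerMn2r edot_le orbT.
Qed.

Fact enormZ (a : R) u : enorm (a *: u) = `|a| * enorm u.
Proof.
by rewrite /enorm edotZl edotZr mulrA -expr2 sqrtrM ?sqr_ge0// sqrtr_sqr.
Qed.

Fact enorm_eq0 u : enorm u = 0 -> u = 0.
Proof. by move=> u0; apply: edot_eq0; rewrite -sqr_enorm u0 expr0n. Qed.

HB.instance Definition _ :=
  @Lmodule_isNormed.Build R E enorm enormD enormZ enorm_eq0.

Lemma coord_le_enorm u i : `|u 0 i| <= `|u|.
Proof.
rewrite -[leLHS]ger0_norm// -sqrtr_sqr ler_sqrt ?edot_ge0//.
rewrite real_normK ?num_real// /edot (bigD1 i)//= expr2 lerDl.
by apply: sumr_ge0 => j _; rewrite -expr2 sqr_ge0.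
Qed.

Lemma enorm_le_sum u : `|u| <= \sum_i `|u 0 i|.
Proof.
have s0 : 0 <= \sum_i `|u 0 i| by apply: sumr_ge0.
rewrite -[leRHS](ger0_norm s0) -sqrtr_sqr ler_sqrt ?sqr_ge0// expr2 mulr_suml.
apply: ler_sum => i _; rewrite -expr2 -real_normK ?num_real// expr2.
by rewrite ler_wpM2l// (bigD1 i)//= lerDl sumr_ge0.
Qed.

Fact euclid_complete (F : set_system E) : ProperFilter F -> cauchy F -> cvg F.
Proof.
move=> FF /cauchyP Fc.
have cvgi i : cvg ((fun v : E => v 0 i) @ F).
  apply: cauchy_cvg; apply: cauchy_exP => e e0.
  have [p Fp] := Fc _ e0; exists (p 0 i).
  apply: (@filterS _ F _ (ball p e)) => //= q.
  rewrite -!ball_normE /= => pq; apply: le_lt_trans pq.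
  by have := coord_le_enorm (p - q : E) i; rewrite !mxE.
pose l : E := \row_i lim ((fun v : E => v 0 i) @ F).
apply/cvg_ex; exists l; apply/cvgrPdist_lt => e e0.
have em0 : 0 < e / m.+1%:R by rewrite divr_gt0.
have : F [set v : E | forall i, `|l 0 i - v 0 i| < e / m.+1%:R].
  apply: filter_forall => i; rewrite mxE.
  by move/cvgrPdist_lt : (cvgi i); apply.
apply: filterS => v lv; apply: (le_lt_trans (enorm_le_sum _)).
apply: (@le_lt_trans _ _ (\sum_(i < m) (e / m.+1%:R))).
  apply: ler_sum => i _; have := ltW (lv i).
  by congr (`|_| <= _); rewrite !mxE.
rewrite sumr_const card_ord -[_ *+ m]mulr_natr -mulrA gtr_pMr//.
by rewrite mulrC ltr_pdivrMr// mul1r ltr_nat.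
Qed.

HB.instance Definition _ := Uniform_isComplete.Build E euclid_complete.

Fact edot_norm u : edot u u = `|u| ^+ 2.
Proof. by rewrite -sqr_enorm. Qed.

HB.instance Definition _ :=
  @CompleteNormedModule_isHilbert.Build R E edot edot_norm.

End Euclid.

Section Operators.
Context {R : realType}.
Implicit Types H : hilbertType R.

Definition nullspace H1 H2 (T : H1 -> H2) : set H1 := [set u | T u = 0].

Definition orthocomp H (D : set H) : set H :=
  [set y | forall d, D d -> '[y, d] = 0].

Definition polar H (D : set H) : set H :=
  [set y | forall d, D d -> '[y, d] <= 0].

(* The point of D nearest to x; it exists and is unique when D is nonempty,
   closed and convex (junk value 0 if there is no nearest point). *)
Definition metric_proj H (D : set H) (x : H) : H :=
  xget 0 [set p | D p /\ forall d, D d -> `|x - p| <= `|x - d|].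

(* The point z representing u |-> <T u, y>; it exists and is unique when T is
   bounded linear (junk value 0 if there is no such point). *)
Definition adjoint H1 H2 (T : H1 -> H2) (y : H2) : H1 :=
  xget 0 [set z | forall u, '[T u, y] = '[u, z]].

Definition generalized_solutions H1 H2 (T : H1 -> H2) (y : H2) : set H1 :=
  [set u | forall v, `|T u - y| <= `|T v - y|].

(* The generalized inverse; the minimal norm element exists and is unique when
   T is bounded linear with closed range (junk value 0 otherwise). *)
Definition ginv H1 H2 (T : H1 -> H2) (y : H2) : H1 :=
  let G := generalized_solutions T y in
  xget 0 [set u | G u /\ forall v, G v -> `|u| <= `|v|].

End Operators.

(* Main.v *)
Require Import Defs.
From mathcomp Require Import all_boot all_order all_algebra.
From mathcomp Require Import all_classical all_reals topology normedtype.
From mathcomp Require Import sesquilinear ring lra.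

Import Order.TTheory GRing.Theory Num.Theory.
Import numFieldNormedType.Exports.

Local Open Scope classical_set_scope.
Local Open Scope ring_scope.

(** Everything reduces to the nonnegative least squares problem of minimizing
    the norm of [x - S rho] over [rho >= 0].  If [rho] solves it, then the
    residual [x - S rho] makes a nonpositive inner product with every [k i] and
    is orthogonal to [S rho] ([nonneg_least_squares]).  Put
    [eta := S^* (S rho - x)].  The first condition says [eta >= 0], the second
    [<rho, eta> = 0], and [eta] is orthogonal to [N(S)] because it lies in the
    range of [S^*].  The same two conditions are the obtuse angle criterion
    [metric_projP] for [S rho] to be the projection of [x] on [C] and for
    [x - S rho] to be its projection on the polar cone: this is Moreau's
    decomposition.

    The generalized inverse only ever acts on vectors [S^* w].  There the
    equation [S^* u = S^* w] is solvable, and its minimal norm solution is the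
    orthogonal projection of [w] on the span of the [k i], which is [S a] for
    any [a] solving the normal equations [S^* (w - S a) = 0]
    ([normal_equations], [ginv_analysis]).  With such an [a] for [w = x] one
    gets [x0 = x - S a] and [ginv S^* eta = S rho - S a], and the required
    identities become linear algebra.

    A minimizing [rho] is obtained without any topology.  The orthogonal
    projections of [x] on the spans of the subfamilies of [k] are finite in
    number, and some of them have nonnegative coefficients.  Every point of the
    cone is at least as far from [x] as one of those ([active_set_descent]), so
    the closest of them is the closest point of the whole cone. *)

(** * Inner products and nearest points *)

Section HilbertTheory.
Context {R : realType} {H : hilbertType R}.
Implicit Types (u v w x p q : H) (D : set H).

Lemma innerC u v : '[u, v] = '[v, u].
Proof. by rewrite (hermC inner u v) expr0 mul1r. Qed.

Lemma innerDl u v w : '[u + v, w] = '[u, w] + '[v, w].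
Proof. exact: linearDl. Qed.

Lemma innerZl a u w : '[a *: u, w] = a * '[u, w].
Proof. exact: linearZl_LR. Qed.

Lemma innerDr u v w : '[w, u + v] = '[w, u] + '[w, v].
Proof. by rewrite innerC innerDl !(innerC w). Qed.

Lemma innerNl u w : '[- u, w] = - '[u, w].
Proof. by rewrite -scaleN1r innerZl mulN1r. Qed.

Lemma innerNr u w : '[w, - u] = - '[w, u].
Proof. by rewrite innerC innerNl innerC. Qed.

Lemma innerBr u v w : '[w, u - v] = '[w, u] - '[w, v].
Proof. by rewrite innerDr innerNr. Qed.

Lemma innerZr a u w : '[w, a *: u] = a * '[w, u].
Proof. by rewrite innerC innerZl innerC. Qed.

Lemma inner0l w : '[0, w] = 0.
Proof. by rewrite -(scale0r 0) innerZl mul0r. Qed.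

Lemma inner0r w : '[w, 0] = 0.
Proof. by rewrite innerC inner0l. Qed.

Lemma inner_suml (I : finType) (F : I -> H) w :
  '[\sum_i F i, w] = \sum_i '[F i, w].
Proof.
elim/big_ind2 : _ => // [|a b c d <- <-]; last exact: innerDl.
exact: inner0l.
Qed.

Lemma inner_eq0 u : '[u, u] = 0 -> u = 0.
Proof.
by rewrite inner_norm => /eqP; rewrite expf_eq0/= normr_eq0 => /eqP.
Qed.

Lemma normD_sqr u v : `|u + v| ^+ 2 = `|u| ^+ 2 + 2 * '[u, v] + `|v| ^+ 2.
Proof. by rewrite -!inner_norm innerDl !innerDr (innerC v u); ring. Qed.

(** When the inner product is nonpositive, the squared norm of [u - v] exceeds
    that of [u] by at least the squared norm of [v]. *)
Lemma norm_le_obtuse {u v} : '[u, v] <= 0 -> `|u| <= `|u - v|.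
Proof.
move=> uv; rewrite -(@ler_pXn2r _ 2) ?nnegrE// normD_sqr innerNr normrN.
have := sqr_ge0 `|v|; lra.
Qed.

(** The equality case of [norm_le_obtuse], which makes nearest points unique. *)
Lemma norm_obtuse_inj {u v} : '[u, v] <= 0 -> `|u - v| <= `|u| -> v = 0.
Proof.
move=> uv; rewrite -(@ler_pXn2r _ 2) ?nnegrE// normD_sqr innerNr normrN => h.
apply/eqP; rewrite -normr_eq0 -sqrf_eq0 eq_le sqr_ge0 andbT; lra.
Qed.

Lemma norm_segment_le (t : R) u v :
  0 <= t -> t <= 1 -> `|v| <= `|u| -> `|(1 - t) *: u + t *: v| <= `|u|.
Proof.
move=> t0 t1 vu; apply: le_trans (ler_normD _ _) _.
rewrite !normrZ (ger0_norm t0) ger0_norm ?subr_ge0//.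
have := ler_wpM2l t0 vu; lra.
Qed.

(** The sufficient half of the variational characterization of projections: for
    [d] in [D], write [x - d = (x - p) - (d - p)] and compare norms. *)
Lemma metric_projP D x p :
  D p -> (forall d, D d -> '[x - p, d - p] <= 0) -> metric_proj D x = p.
Proof.
move=> Dp obt; apply: xget_unique => [|q [Dq qmin]].
  split=> // d /obt/norm_le_obtuse.
  by rewrite opprB addrA subrK.
apply/eqP; rewrite -subr_eq0; apply/eqP.
apply: (norm_obtuse_inj (obt _ Dq)).
by rewrite opprB addrA subrK; exact: qmin.
Qed.

End HilbertTheory.

(** * The synthesis operator, its adjoint and the generalized inverse *)

Section Frame.
Context {R : realType} {H : hilbertType R} {m : nat}.
Variable k : 'I_m -> H.
Implicit Types (x y w : H) (a b rho sigma tau : euclid R m).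

Definition synthesis a : H := \sum_i a 0 i *: k i.

(** An explicit formula for [S^* y]; see [adjoint_synthesis]. *)
Definition analysis y : euclid R m := \row_i '[k i, y].

Local Notation S := synthesis.
Local Notation T := analysis.

Lemma synthesisD a b : S (a + b) = S a + S b.
Proof. by rewrite -big_split; apply: eq_bigr => i _; rewrite mxE scalerDl. Qed.

Lemma synthesisZ c a : S (c *: a) = c *: S a.
Proof. by rewrite scaler_sumr; apply: eq_bigr => i _; rewrite mxE scalerA. Qed.

Lemma synthesisB a b : S (a - b) = S a - S b.
Proof. by rewrite synthesisD -scaleN1r synthesisZ scaleN1r. Qed.

Lemma synthesis_delta c j : S (c *: delta_mx 0 j : 'rV_m) = c *: k j.
Proof.
rewrite /S (bigD1 j)//= !mxE !eqxx mulr1 big1 ?addr0// => i ij.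
by rewrite !mxE (negPf ij) mulr0 scale0r.
Qed.

Lemma inner_synthesis a y : '[S a, y] = \sum_i a 0 i * '[k i, y].
Proof. by rewrite inner_suml; apply: eq_bigr => i _; rewrite innerZl. Qed.

Lemma synthesis_analysis a y : '[S a, y] = '[a, T y].
Proof.
by rewrite inner_synthesis; apply: eq_bigr => i _; rewrite mxE.
Qed.

Lemma adjoint_synthesis : adjoint S = T.
Proof.
apply/funext => y; apply: xget_unique => [a|z zP]; first exact: synthesis_analysis.
apply/eqP; rewrite -subr_eq0; apply/eqP; apply: inner_eq0.
by rewrite innerBr -zP synthesis_analysis subrr.
Qed.

Lemma analysisD x y : T (x + y) = T x + T y.
Proof. by apply/rowP => i; rewrite !mxE innerDr. Qed.

Lemma analysisB x y : T (x - y) = T x - T y.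
Proof. by apply/rowP => i; rewrite !mxE innerBr. Qed.

(** The data [T w] is attained, so the generalized solutions are the exact
    solutions of [T u = T w].  They all differ from [S a] by an element of
    [N(T)], which is orthogonal to the range of [S]: by Pythagoras [S a] is the
    shortest one. *)
Lemma ginv_analysis w a :
  T (w - S a) = 0 -> ginv T (T w) = S a.
Proof.
rewrite analysisB => /eqP; rewrite subr_eq0 => /eqP Tw.
have genP u : generalized_solutions T (T w) u <-> T u = T w.
  split=> [/(_ w)|Tu v]; last by rewrite Tu subrr normr0.
  by rewrite subrr normr0 normr_le0 subr_eq0 => /eqP.
have orth u : T u = T w -> '[S a, S a - u] = 0.
  by move=> Tu; rewrite synthesis_analysis analysisB Tu Tw subrr inner0r.
apply: xget_unique => [|u [/genP Tu umin]].
  split=> [|v /genP Tv]; first exact/genP.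
  by rewrite -[v](subKr (S a)) norm_le_obtuse// orth.
apply/eqP; rewrite eq_sym -subr_eq0; apply/eqP.
apply: (@norm_obtuse_inj _ _ (S a)); first by rewrite orth.
by rewrite subKr; apply: umin; apply/genP.
Qed.

(** Existence of the orthogonal projection on the span of the family.  The Gram
    system [a G = T x] is solvable because its right-hand side is orthogonal to
    the kernel of [G]: if [G c = 0] then [S c] has norm [0], and the product of
    [T x] with [c] is the inner product of [x] with [S c]. *)
Lemma normal_equations x : exists a, T (x - S a) = 0.
Proof.
pose G : 'M[R]_m := \matrix_(i, j) '[k i, k j].
have mulG (a : 'rV_m) : a *m G = T (S a).
  apply/rowP => j; rewrite !mxE innerC inner_synthesis.
  by apply: eq_bigr => i _; rewrite mxE.
suff /submxP[a Da] : ((T x : 'rV_m) <= G)%MS.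
  by exists a; rewrite analysisB -mulG Da subrr.
rewrite submxE; apply/eqP/rowP => j; rewrite [RHS]mxE.
pose c : 'rV_m := (col j (cokermx G))^T.
have symG : G^T = G by apply/matrixP => p q; rewrite !mxE innerC.
have cG : c *m G = 0.
  by rewrite -[G]symG -trmx_mul colE mulmxA mulmx_coker mul0mx trmx0.
have Sc : S c = 0.
  by apply: inner_eq0; rewrite synthesis_analysis -mulG cG inner0r.
transitivity '[S c, x].
  by rewrite inner_synthesis mxE; apply: eq_bigr => i _; rewrite !mxE mulrC.
by rewrite Sc inner0l.
Qed.

End Frame.

(** * Nonnegative least squares *)

Section ActiveSet.
Context {R : realType} {H : hilbertType R} {m : nat}.
Variables (k : 'I_m -> H) (x : H).
Implicit Types (I : {set 'I_m}) (a b rho sigma tau : euclid R m).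
Local Notation S := (synthesis k).

Definition supported I a := forall i, i \notin I -> a 0 i = 0.

(** The coefficients, carried by [I], of the orthogonal projection of [x] on the
    span of the [k i] with [i] in [I].  They need not be unique, but the point
    [S a] is. *)
Definition fits I a := supported I a /\ forall i, i \in I -> '[x - S a, k i] = 0.

Definition nonneg a := forall i, 0 <= a 0 i.

Lemma fits_exists I : exists a, fits I a.
Proof.
(* Killing the vectors outside I makes their coefficients immaterial. *)
pose f i := if i \in I then k i else 0.
have [a Ta] := normal_equations f x.
pose b : euclid R m := \row_i (if i \in I then a 0 i else 0).
have Sb : S b = synthesis f a.
  apply: eq_bigr => i _; rewrite mxE /f.
  by case: ifP; rewrite ?scale0r ?scaler0.
exists b; split=> [i /negPf iI|i iI]; first by rewrite mxE iI.
by move/rowP/(_ i): Ta; rewrite !mxE /f iI Sb innerC.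
Qed.

Lemma fits_inner {I a b} : fits I a -> supported I b -> '[x - S a, S b] = 0.
Proof.
move=> [_ fa] sb; rewrite innerC inner_synthesis big1// => i _.
have [iI|/sb->] := boolP (i \in I); last by rewrite mul0r.
by rewrite innerC fa// mulr0.
Qed.

Lemma fits_le {I a b} : fits I a -> supported I b -> `|x - S a| <= `|x - S b|.
Proof.
move=> fa sb; have [sa _] := fa.
have -> : x - S b = (x - S a) - S (b - a) by rewrite synthesisB opprB addrA subrK.
apply: norm_le_obtuse; rewrite (fits_inner fa)//.
by move=> i iI; rewrite !mxE sa// sb// subrr.
Qed.

(** By induction on the number of nonzero coefficients of [sigma].  Let [tau] be
    the projection coefficients on the support of [sigma].  If they are
    nonnegative they will do; otherwise, walking from [sigma] towards [tau] until
    a first coefficient vanishes does not increase the distance to [x] and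
    shrinks the support. *)
Lemma active_set_descent sigma : nonneg sigma ->
  exists I rho, [/\ fits I rho, nonneg rho & `|x - S rho| <= `|x - S sigma|].
Proof.
have [n] := ubnP #|[set i | sigma 0 i != 0]%SET|.
elim: n sigma => // n IH sigma; set I := [set i | _]%SET => In sigma0.
have sI : supported I sigma by move=> i; rewrite inE negbK => /eqP.
have [tau ftau] := fits_exists I.
have [tausup _] := ftau.
have [/forallP tau0|] := boolP [forall i, 0 <= tau 0 i].
  by exists I, tau; split=> //; exact: fits_le ftau sI.
rewrite negb_forall => /existsP[i0]; rewrite -ltNge => i0P.
(* r i is the time at which coordinate i vanishes on the segment to tau. *)
pose r i := sigma 0 i / (sigma 0 i - tau 0 i).
case: (@arg_minP _ _ _ i0 (fun i => tau 0 i < 0) r i0P) => j tauj jmin.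
have sj : 0 <= sigma 0 j := sigma0 j.
have dj : 0 < sigma 0 j - tau 0 j by lra.
have t0 : 0 <= r j by rewrite divr_ge0// ltW.
have t1 : r j <= 1 by rewrite ler_pdivrMr//; lra.
pose s : euclid R m := (1 - r j) *: sigma + r j *: tau.
have s0 : nonneg s.
  move=> i; rewrite !mxE.
  have si := sigma0 i.
  have [ti|ti] := leP 0 (tau 0 i).
    by rewrite addr_ge0// mulr_ge0// subr_ge0.
  have di : 0 < sigma 0 i - tau 0 i by lra.
  have := jmin i ti; rewrite {2}/r ler_pdivlMr//; lra.
have sjE : s 0 j = 0.
  rewrite !mxE /r; field; lra.
have jI : j \in I.
  by apply: contraLR tauj => /tausup->; rewrite ltxx.
have card_s : (#|[set i | s 0%R i != 0%R]%SET| < n)%N.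
  rewrite ltnS in In; apply: leq_trans In; apply: proper_card.
  apply/properP; split; last by exists j; rewrite // inE sjE eqxx.
  apply/fintype.subsetP => i; rewrite inE; apply: contraNT => iI.
  by rewrite !mxE (sI _ iI) (tausup _ iI) !mulr0 addr0.
have [J [rho [frho rho0 rho_le]]] := IH s card_s s0.
exists J, rho; split=> //; apply: le_trans rho_le _.
have -> : x - S s = (1 - r j) *: (x - S sigma) + r j *: (x - S tau).
  rewrite synthesisD !synthesisZ !scalerBr addrACA -scalerDl subrK scale1r.
  by rewrite opprD.
apply: norm_segment_le => //; exact: fits_le ftau sI.
Qed.

(** The optimality conditions of nonnegative least squares.  The minimizer fits
    some index set, whence the orthogonality; a positive inner product of the
    residual with [k j] would allow a move along [k j] that comes strictly closer
    to [x]. *)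
Lemma nonneg_least_squares : exists rho,
  [/\ nonneg rho, forall i, '[x - S rho, k i] <= 0 & '[x - S rho, S rho] = 0].
Proof.
pose good I := `[<exists rho, fits I rho /\ nonneg rho>].
have /boolp.choice[f fP] I : exists a, good I -> fits I a /\ nonneg a.
  by have [/asboolP[a aP]|_] := boolP (good I); [exists a | exists 0].
have good0 : good finset.set0.
  apply/asboolP; have [a fa] := fits_exists finset.set0; exists a; split=> // i.
  by have [-> //] := fa; rewrite inE.
case: (@arg_minP _ _ _ _ good (fun I => `|x - S (f I)|) good0) => I gI fmin.
have [fitI f0] := fP I gI; have [sI _] := fitI.
have minI sigma : nonneg sigma -> `|x - S (f I)| <= `|x - S sigma|.
  case/active_set_descent => J [rho [frho rho0]]; apply: le_trans.
  have gJ : good J by apply/asboolP; exists rho.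
  have [fitJ _] := fP J gJ; have [srho _] := frho.
  by apply: le_trans (fits_le fitJ srho); exact: fmin.
exists (f I); split=> // [j|]; last exact: fits_inner fitI sI.
rewrite leNgt; apply/negP => rj.
have kj : 0 < `|k j| ^+ 2.
  rewrite exprn_gt0// normr_gt0; apply: contraTneq rj => ->.
  by rewrite inner0r ltxx.
(* The step minimizing the distance along the ray spanned by k j. *)
pose t := '[x - S (f I), k j] / `|k j| ^+ 2.
have t0 : 0 < t by rewrite divr_gt0.
have /minI : nonneg (f I + t *: delta_mx 0 j).
  by move=> i; rewrite !mxE addr_ge0// mulr_ge0 ?ler0n// ltW.
rewrite synthesisD synthesis_delta opprD addrA -(@ler_pXn2r _ 2) ?nnegrE//.
rewrite (normD_sqr (x - S (f I))) innerNr innerZr normrN normrZ exprMn.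
rewrite (ger0_norm (ltW t0)).
have -> : t ^+ 2 * `|k j| ^+ 2 = t * '[x - S (f I), k j].
  by rewrite expr2 -mulrA /t divfK// gt_eqF.
have := mulr_gt0 t0 rj; lra.
Qed.

End ActiveSet.

(** * The decomposition *)

Theorem theorem3p16 (R : realType) (H : hilbertType R) (m : nat)
    (k : 'I_m -> H) :
  let C : set H := [set y | exists rho : euclid R m,
    (forall i, 0 <= rho 0 i) /\ y = \sum_i rho 0 i *: k i] in
  let S (alpha : euclid R m) : H := \sum_i alpha 0 i *: k i in
  let Sstar : H -> euclid R m := adjoint S in
  let Sstar_ginv : euclid R m -> H := ginv Sstar in
  forall x : H,
  let x0 := x - Sstar_ginv (Sstar x) in
  nullspace Sstar x0 /\
  exists rho eta : euclid R m,
  [/\ x = S rho + x0 - Sstar_ginv eta,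
      [/\ forall i, 0 <= rho 0 i,
          forall i, 0 <= eta 0 i,
          orthocomp (nullspace S) eta
        & '[rho, eta] = 0],
      metric_proj (polar C) x = x0 - Sstar_ginv eta /\ '[x0, Sstar_ginv eta] = 0
    & metric_proj C x = S rho /\ S rho = Sstar_ginv (Sstar x + eta)].
Proof.
move=> C S Sstar Sginv x.
have SE : S = synthesis k by [].
have SsE : Sstar = analysis k by exact: adjoint_synthesis.
have [a aP] := normal_equations k x.
have [rho [rho0 rk rr]] := nonneg_least_squares k x.
set eta := analysis k (S rho - x).
have Sx : Sginv (Sstar x) = S a by rewrite /Sginv SsE; exact: ginv_analysis.
have Seta : Sginv eta = S rho - S a.
  rewrite /Sginv SsE SE -synthesisB; apply: ginv_analysis.
  rewrite synthesisB opprB addrC addrA subrK.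
  move: aP; rewrite !analysisB => /eqP; rewrite subr_eq0 => /eqP->.
  by rewrite subrr.
have Sxeta : Sginv (Sstar x + eta) = S rho.
  rewrite /Sginv SsE -analysisD addrC subrK; apply: ginv_analysis.
  by rewrite subrr; apply/rowP => i; rewrite !mxE inner0r.
rewrite /= Sx; split; first by rewrite /nullspace/= SsE.
have eta0 i : 0 <= eta 0 i.
  by rewrite mxE innerC -opprB innerNl oppr_ge0 rk.
have cone_le d : C d -> '[x - S rho, d] <= 0.
  move=> [sigma [sigma0 ->]]; rewrite innerC inner_synthesis.
  apply: sumr_le0 => i _; rewrite mulr_ge0_le0// innerC; exact: rk.
have resid : x - S a - Sginv eta = x - S rho.
  by rewrite Seta opprB addrA subrK.
exists rho, eta; rewrite resid -addrA resid; split.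
- by rewrite addrC subrK.
- split=> //.
    by move=> d Sd; rewrite innerC -synthesis_analysis -SE Sd inner0l.
  by rewrite -synthesis_analysis -opprB innerNr innerC rr oppr0.
- split.
    apply: metric_projP => // d dC; rewrite subKr innerBr [X in _ - X]innerC rr.
    by rewrite subr0 innerC; apply: dC; exists rho.
  rewrite Seta SE -synthesisB innerC synthesis_analysis.
  by rewrite aP inner0r.
- split; last by rewrite Sxeta.
  apply: metric_projP => [|d Cd]; first by exists rho.
  by rewrite innerBr rr subr0 cone_le.
Qed.
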